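(* Let $y^\delta\in Y$, $\tau\ge 1$, $\delta>0$ be fixed with $\mathcal S(y,y^\delta)\le\delta$, and let, for two functionals $\mathcal R:X\to[0,\infty]$, $\mathcal S:Y\times Y\to[0,\infty]$, conditions (i)--(v) of the context hold, with $x^\dagger$ an $\mathcal R$-minimizing solution of $F(x)=y$. (1) Then $x^\delta_{Mo}$ and, for any $\rho\ge\rho_*^{II}$, $x^\delta_\rho$ are well-defined. In particular, $x^\delta_\rho$ with $\rho=\rho_*^I$ according to rule I or with $\rho=\rho_*^{II}$ according to rule II are well defined, and the relations $$\rho_*^{II}\le\rho_*^I=\mathcal R(x^\dagger)$$ and $$\mathcal R(x^\delta_{Mo})\le\mathcal R(x^\dagger),\quad \mathcal R(x^\delta_{\rho_*^I})\le\mathcal R(x^\dagger),\quad \mathcal R(x^\delta_{\rho_*^{II}})\le\mathcal R(x^\dagger),$$ $$\mathcal S(F(x^\delta_{Mo}),y^\delta)\le\tau\delta,\quad \mathcal S(F(x^\delta_{\rho_*^I}),y^\delta)\le\delta,\quad \mathcal S(F(x^\delta_{\rho_*^{II}}),y^\delta)\le\tau\delta$$ hold. Moreover, the monotonicity relation $$\rho_1\le\rho_2\ \Rightarrow\ \mathcal S(F(x^\delta_{\rho_1}),y^\delta)\ge\mathcal S(F(x^\delta_{\rho_2}),y^\delta)\qquad(\ast)$$ holds for all $\rho_1,\rho_2\ge\rho_*^{II}$ and any two minimizers $x^\delta_{\rho_i}$ of the Ivanov problem with radius $\rho=\rho_i$, $i\in\{1,2\}$. (2) If additionally condition (vi) of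 the context holds, then well-definedness of $x^\delta_\rho$ and the monotonicity relation $(\ast)$ extend to the interval $[\min\{\rho_0,\rho_*^{II}\},\infty)$, and also $x^\delta_\rho$ with $\rho=\rho_*^{III}$ according to rule III is well defined and satisfies $$\rho_*^{III}\le\rho_*^I=\mathcal R(x^\dagger),\qquad \mathcal R(x^\delta_{\rho_*^{III}})\le\mathcal R(x^\dagger),\qquad \mathcal S(F(x^\delta_{\rho_*^{III}}),y^\delta)\le\tau\delta .$$
   Context: Setting: $(X,\mathcal T_X)$, $(Y,\mathcal T_Y)$ are topological spaces, $F:\mathcal D(F)\subseteq X\to Y$, and $y\in F(\mathcal D(F))$. An $\mathcal R$-minimizing solution of $F(x)=y$ is an element of $\mathcal D(F)$ minimizing $\mathcal R$ among all solutions of $F(x)=y$. For $\rho\ge0$ put $X^{ad}(\rho)=\{x\in\mathcal D(F):\mathcal R(x)\le\rho\}$. Morozov problem: minimize $\mathcal R(x)$ over $x\in\mathcal D(F)$ subject to $\mathcal S(F(x),y^\delta)\le\tau\delta$; a minimizer is denoted $x^\delta_{Mo}$. Ivanov problem with radius $\rho\ge0$: minimize $\mathcal S(F(x),y^\delta)$ over $x\in X^{ad}(\rho)$; a minimizer is denoted $x^\delta_\rho$. ''Well-defined'' means that a minimizer (and, where the radius is given by a rule, a radius according to that rule) exists. Choices of the radius. Rule I: $\rho_*^I=\mathcal R(x^\dagger)$. Rule II: $\rho_*^{II}$ is the minimum of the set of all $\rho\ge0$ such that a minimizer $x^\delta_\rho$ of the Ivanov problem exists and $\mathcal S(F(x^\delta_\rho),y^\delta)\le\tau\delta$.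 Rule III: $\rho_*^{III}$ is a $\rho$ such that a minimizer $x^\delta_\rho$ of the Ivanov problem exists and $\delta<\mathcal S(F(x^\delta_\rho),y^\delta)\le\tau\delta$. In all of these $\tau\ge1$ is a fixed constant independent of $\delta$. Conditions: (i) $F$ is $\mathcal T_X$-$\mathcal T_Y$-sequentially closed: if $(x_n)_{n\in\mathbb N}\subseteq\mathcal D(F)$, $x_n\to x$ in $\mathcal T_X$ and $F(x_n)\to z$ in $\mathcal T_Y$, then $x\in\mathcal D(F)$ and $F(x)=z$. (ii) $\mathcal R$ and $\mathcal S(\cdot,y^\delta)$ are lower semicontinuous with respect to $\mathcal T_X$ and $\mathcal T_Y$, respectively. (iii) For any $C>0$ the sublevel set $\{x\in\mathcal D(F):\mathcal R(x)\le C\}$ is $\mathcal T_X$-compact. (iv) For any $C>0$ and any $y^\delta\in Y$ the sublevel set $\{z\in F(\mathcal D(F)):\mathcal S(z,y^\delta)\le C\}$ is $\mathcal T_Y$-compact. (v) There exists a solution $x^\dagger$ of $F(x)=y$ with $\mathcal R(x^\dagger)<\infty$. (vi) There exists $\rho_0\ge0$ such that a minimizer $x^\delta_{\rho_0}$ of the Ivanov problem with radius $\rho_0$ exists and $\delta<\mathcal S(F(x^\delta_{\rho_0}),y^\delta)$. If $\rho_0<\rho_*^{II}$, then additionally: (a) for all $\rho\in(\rho_0,\rho_*^{II}]$ and all zero sequences $(d_n)_{n\in\mathbb N}$ (i.e. real sequences with $d_n\to0$) there exists a sequence of mappings $\varphi_n:X^{ad}(\rho)\to X^{ad}(\rho+d_n)$,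 $n\in\mathbb N$, such that $\mathcal S(F(\varphi_n(x)),y^\delta)\to\mathcal S(F(x),y^\delta)$ as $n\to\infty$ for all $x\in X^{ad}(\rho)$; (b) for all $\rho\in(\rho_0,\rho_*^{II}]$ at most one minimizer $x^\delta_\rho$ of the Ivanov problem exists.
   Formalization: Compactness in (iii), (iv) is taken as sequential compactness (with open covers (1) can fail); in (vi)(a), if only zero sequences with ρ+d_n≥0 are tested, existence of a rule III radius is claimed for τ>1 only, since δ<S≤τδ is impossible at τ=1. *)

(* Defs.v *)
From HB Require Import structures.
From mathcomp Require Import all_boot all_order all_algebra.
From mathcomp Require Import all_classical all_reals all_analysis.
Import numFieldNormedType.Exports.
Import Order.TTheory GRing.Theory Num.Theory.
Set Implicit Arguments.
Unset Strict Implicit.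
Unset Printing Implicit Defensive.
Local Open Scope classical_set_scope.
Local Open Scope ring_scope.
Local Open Scope ereal_scope.

(* A partial map with domain [D] is a total map [F] together with the set [D];
   no definition below looks at the values of [F] outside [D]. *)

Definition minimizer {R : realType} {T : Type} (A : set T) (f : T -> \bar R)
    (x : T) : Prop :=
  A x /\ forall x', A x' -> f x <= f x'.

Definition minimum {R : realType} (A : set R) (r : R) : Prop :=
  A r /\ lbound A r.

(* Compactness is taken in the sequential sense, as is the closedness of [F]:
   with open-cover compactness a sequentially closed [F] need not admit any
   Ivanov minimizer, e.g. on the Stone-Cech compactification of nat, where
   convergent sequences are eventually constant and every [F] into a Hausdorff
   space is sequentially closed. *)
Definition sequentially_compact {T : topologicalType} (A : set T) : Prop :=
  forall u : nat -> T, (forall n, A (u n)) ->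
    exists2 k : nat -> nat, increasing_seq k &
      exists2 x, A x & u \o k @ \oo --> x.

Definition sequentially_closed_map {X Y : topologicalType} (D : set X)
    (F : X -> Y) : Prop :=
  forall (u : nat -> X) (x : X) (z : Y), (forall n, D (u n)) ->
    u @ \oo --> x -> F \o u @ \oo --> z -> D x /\ F x = z.

Definition solutions {X Y : Type} (D : set X) (F : X -> Y) (y : Y) : set X :=
  [set x | D x /\ F x = y].

Definition Xad {R : realType} {X : Type} (D : set X) (Reg : X -> \bar R)
    (rho : R) : set X :=
  [set x | D x /\ Reg x <= rho%:E].

Definition morozov {R : realType} {X Y : Type} (D : set X) (F : X -> Y)
    (Reg : X -> \bar R) (S : Y -> Y -> \bar R) (yd : Y) (tau delta : R)
    (x : X) : Prop :=
  minimizer [set x | D x /\ S (F x) yd <= (tau * delta)%:E] Reg x.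

Definition ivanov {R : realType} {X Y : Type} (D : set X) (F : X -> Y)
    (Reg : X -> \bar R) (S : Y -> Y -> \bar R) (yd : Y) (rho : R)
    (x : X) : Prop :=
  minimizer (Xad D Reg rho) (fun x => S (F x) yd) x.

Definition rule_I {R : realType} {X : Type} (Reg : X -> \bar R) (xdag : X)
    (rho : R) : Prop :=
  rho%:E = Reg xdag.

Definition rule_II {R : realType} {X Y : Type} (D : set X) (F : X -> Y)
    (Reg : X -> \bar R) (S : Y -> Y -> \bar R) (yd : Y) (tau delta : R)
    (rho : R) : Prop :=
  minimum [set r : R | (0 <= r)%R /\
    exists2 x, ivanov D F Reg S yd r x & S (F x) yd <= (tau * delta)%:E] rho.

Definition rule_III {R : realType} {X Y : Type} (D : set X) (F : X -> Y)
    (Reg : X -> \bar R) (S : Y -> Y -> \bar R) (yd : Y) (tau delta : R)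
    (rho : R) : Prop :=
  (0 <= rho)%R /\
  exists2 x, ivanov D F Reg S yd rho x &
    delta%:E < S (F x) yd <= (tau * delta)%:E.

Definition ivanov_well_defined_from {R : realType} {X Y : Type} (D : set X)
    (F : X -> Y) (Reg : X -> \bar R) (S : Y -> Y -> \bar R) (yd : Y)
    (r : R) : Prop :=
  forall rho : R, (r <= rho)%R -> exists x, ivanov D F Reg S yd rho x.

Definition ivanov_monotone_from {R : realType} {X Y : Type} (D : set X)
    (F : X -> Y) (Reg : X -> \bar R) (S : Y -> Y -> \bar R) (yd : Y)
    (r : R) : Prop :=
  forall (rho1 rho2 : R) (x1 x2 : X), (r <= rho1)%R -> (r <= rho2)%R ->
    ivanov D F Reg S yd rho1 x1 -> ivanov D F Reg S yd rho2 x2 ->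
    (rho1 <= rho2)%R -> S (F x2) yd <= S (F x1) yd.

(* [adm] is the set of radii r for which [Xad D Reg r] is regarded as
   meaningful: only zero sequences d with all rho + d n in [adm] are tested.
   - [adm = setT] allows all zero sequences; since [Xad D Reg r] is empty for
     r < 0, the condition is then unsatisfiable as soon as [Xad D Reg rho] is
     nonempty.
   - [adm = [set r | 0 <= r]] keeps the sequences along which the admissible
     sets are defined. *)
Definition approximable {R : realType} {X Y : Type} (D : set X) (F : X -> Y)
    (Reg : X -> \bar R) (S : Y -> Y -> \bar R) (yd : Y) (adm : set R)
    (rho : R) : Prop :=
  forall d : nat -> R, d @ \oo --> (0 : R)%R ->
    (forall n, adm (rho + d n)%R) ->
    exists2 phi : nat -> X -> X,
      forall n, set_fun (Xad D Reg rho) (Xad D Reg (rho + d n)%R) (phi n) &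
      forall x, Xad D Reg rho x ->
        S (F (phi n x)) yd @[n --> \oo] --> S (F x) yd.

Definition rule_III_condition {R : realType} {X Y : Type} (D : set X) (F : X -> Y)
    (Reg : X -> \bar R) (S : Y -> Y -> \bar R) (yd : Y) (delta : R)
    (adm : set R) (rhoII rho0 : R) : Prop :=
  [/\ (0 <= rho0)%R,
      exists2 x, ivanov D F Reg S yd rho0 x & delta%:E < S (F x) yd &
      (rho0 < rhoII)%R -> forall rho : R, (rho0 < rho <= rhoII)%R ->
        approximable D F Reg S yd adm rho /\
        (forall x1 x2, ivanov D F Reg S yd rho x1 ->
           ivanov D F Reg S yd rho x2 -> x1 = x2)].

(* Main.v *)
Require Import Defs.
From mathcomp Require Import all_boot all_order all_algebra.
From mathcomp Require Import all_classical all_reals all_analysis.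
Import numFieldNormedType.Exports.
Import Order.TTheory GRing.Theory Num.Theory.
Set Implicit Arguments.
Unset Strict Implicit.
Unset Printing Implicit Defensive.
Local Open Scope classical_set_scope.
Local Open Scope ring_scope.
Local Open Scope ereal_scope.

(** The whole argument rests on one compactness statement, [feasible_closed]:
    the set of pairs of levels (r, s) for which some x in D has [Reg x <= r]
    and [S (F x) yd <= s] is closed from above.  Points that are feasible up to
    1/(n+1) lie in a sublevel set of [Reg] and their images in a sublevel set
    of [S], so a subsequence converges together with its image; closedness of
    [F] identifies the limit of the images as the image of the limit, and lower
    semicontinuity bounds both functionals there ([feasible_closedP]).
    Together with [minimizer_exists] this makes both problems solvable: Ivanov
    whenever its admissible set is nonempty, Morozov because [xdag] is
    admissible for it.

    The two problems determine each other.  A Morozov minimizer xMo has residual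
    at most tau * delta, and any point with such a residual satisfies
    [Reg xMo <= Reg x]; hence the radius of rule II is exactly [Reg xMo], and
    Ivanov values above tau * delta are precisely those of smaller radii.
    Since [xdag] is admissible for Morozov, rhoII <= rhoI.

    For rule III, let rho0 be a radius with Ivanov value above delta.  If
    rhoII <= rho0, then monotonicity bounds that value by tau * delta, and rho0
    itself is a radius for rule III.  If rho0 < rhoII, all radii below rhoII
    have value above tau * delta, and approximating the admissible set at rhoII
    from below carries the bound [tau * delta <= S (F x) yd] to rhoII
    ([residual_ge_from_below]); the value at rhoII is therefore exactly
    tau * delta, which exceeds delta when 1 < tau.  When the zero sequences may
    leave the nonnegative radii, the approximation property contradicts the
    nonemptiness of the admissible set, since sets of negative radius are
    empty, so that rho0 < rhoII cannot occur. *)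

(** * Sequential compactness and lower semicontinuity *)

Lemma leq_increasing_seq (k : nat -> nat) (n : nat) :
  increasing_seq k -> (n <= k n)%N.
Proof.
move=> kmono; elim: n => // n IHn.
by apply: (leq_ltn_trans IHn); rewrite ltnNge -leEnat kmono ltnn.
Qed.

Lemma lower_semicontinuous_cvg_le {R : realType} {T : topologicalType}
    (f : T -> \bar R) (u : nat -> T) (x : T) (c : R) :
  lower_semicontinuous f -> u @ \oo --> x ->
  (forall n, f (u n) <= (c + n.+1%:R^-1)%:E) -> f x <= c%:E.
Proof.
move=> flsc ux fu; apply/lee_addgt0Pr => e e0; rewrite leNgt; apply/negP.
rewrite -EFinD => /flsc[V xV fV].
have [n [Vn ne]] : exists n, V (u n) /\ (n.+1%:R^-1 < e)%R.
  near \oo => n; exists n; split; near: n; first exact: ux.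
  exact: (near_infty_natSinv_lt (PosNum e0)).
have := lt_le_trans (fV _ Vn) (fu n).
by rewrite lte_fin ltrD2l ltNge (ltW ne).
Unshelve. all: by end_near. Qed.

(** The hypothesis on c, applied to the infimum of f over A, turns a minimizing
    sequence into a minimizer; when that infimum is infinite, f is constant on
    A and every point of A is a minimizer. *)
Lemma minimizer_exists {R : realType} {T : Type} (A : set T) (f : T -> \bar R) :
  A !=set0 -> (forall x, 0 <= f x) ->
  (forall c : R,
     (forall e, (0 < e)%R -> exists2 x, A x & f x <= (c + e)%:E) ->
     exists2 x, A x & f x <= c%:E) ->
  exists x, minimizer A f x.
Proof.
move=> [a Aa] f0 fA; set m := ereal_inf (f @` A).
have mle x : A x -> m <= f x by move=> Ax; apply: ereal_inf_lbound; exists x.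
have m0 : 0 <= m by apply: le_ereal_inf_tmp => _ [x _ <-].
have [mfin|] := boolP (m \is a fin_num); last first.
  rewrite ge0_fin_numE// -leNgt leye_eq => /eqP my.
  by exists a; split=> // x /mle; rewrite my leye_eq => /eqP ->; rewrite leey.
have [|x Ax fx] := fA (fine m).
  move=> e e0; have [_ [x Ax <-] fx] := lb_ereal_inf_adherent e0 mfin.
  by exists x => //; rewrite EFinD fineK// ltW.
by exists x; split=> // x' /mle; apply: le_trans; rewrite fineK in fx.
Qed.

(** * Solvability of the Morozov and Ivanov problems *)

(** Both levels are relaxed at once, so that the same property serves the
    Morozov problem, where r approaches the infimum at fixed s, and the Ivanov
    problem, where the two roles are exchanged. *)
Definition feasible_closed {R : realType} {X Y : Type} (D : set X) (F : X -> Y)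
    (Reg : X -> \bar R) (S : Y -> Y -> \bar R) (yd : Y) : Prop :=
  forall r s : R,
    (forall e, (0 < e)%R -> exists x,
      [/\ D x, Reg x <= (r + e)%:E & S (F x) yd <= (s + e)%:E]) ->
    exists x, [/\ D x, Reg x <= r%:E & S (F x) yd <= s%:E].

(** Compactness has to be used twice: a convergent subsequence of the points
    need not have convergent images, and [F] is only known to be closed.  Along
    a subsequence the errors 1/(n+1) only decrease, which keeps the bounds
    needed for lower semicontinuity. *)
Lemma feasible_closedP (R : realType) (X Y : topologicalType)
    (D : set X) (F : X -> Y) (Reg : X -> \bar R) (S : Y -> Y -> \bar R)
    (yd : Y) :
  sequentially_closed_map D F ->
  lower_semicontinuous Reg -> lower_semicontinuous (S ^~ yd) ->
  (forall C : R, (0 < C)%R ->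
    sequentially_compact [set x | D x /\ Reg x <= C%:E]) ->
  (forall C : R, (0 < C)%R ->
    sequentially_compact [set z | (F @` D) z /\ S z yd <= C%:E]) ->
  feasible_closed D F Reg S yd.
Proof.
move=> Fcl Rlsc Slsc Rcpt Scpt r s rs.
have /choice[u uP] : forall n : nat, exists x,
    [/\ D x, Reg x <= (r + n.+1%:R^-1)%:E & S (F x) yd <= (s + n.+1%:R^-1)%:E].
  by move=> n; apply: rs; rewrite invr_gt0.
have bound (c : R) (n : nat) : (c + n.+1%:R^-1 <= `|c| + 1)%R.
  by apply: lerD; [exact: ler_norm | rewrite invf_le1// ler1n].
have pos (c : R) : (0 < `|c| + 1)%R by rewrite ltr_wpDl.
have [|k kmono [x _ ux]] := Rcpt _ (pos r) u.
  move=> n; have [Du Ru _] := uP n; split=> //.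
  by apply: (le_trans Ru); rewrite lee_fin.
have [|l lmono [z _ Fz]] := Scpt _ (pos s) (F \o u \o k).
  move=> n; have [Du _ Su] := uP (k n); split; first by exists (u (k n)).
  by apply: (le_trans Su); rewrite lee_fin.
have loo : l @ \oo --> \oo.
  move=> A [N _ NA]; exists N => // n /= Nn; apply: NA => /=.
  exact: leq_trans Nn (leq_increasing_seq _ lmono).
have ukl : u \o k \o l @ \oo --> x by exact: cvg_comp loo ux.
have slack (n : nat) (c : R) : (c + (k (l n)).+1%:R^-1 <= c + n.+1%:R^-1)%R.
  rewrite lerD2l lef_pV2 ?posrE// ler_nat ltnS.
  exact: leq_trans (leq_increasing_seq _ lmono) (leq_increasing_seq _ kmono).
have [Dx Fx] : D x /\ F x = z.
  by apply: (Fcl (u \o k \o l)) => // n; have [] := uP (k (l n)).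
exists x; split=> //.
  apply: (lower_semicontinuous_cvg_le Rlsc ukl) => n.
  have [_ Ru _] := uP (k (l n)); by apply: (le_trans Ru); rewrite lee_fin.
rewrite Fx; apply: (lower_semicontinuous_cvg_le Slsc Fz) => n.
have [_ _ Su] := uP (k (l n)); by apply: (le_trans Su); rewrite lee_fin.
Qed.

Lemma Xad_le {R : realType} {X : Type} (D : set X) (Reg : X -> \bar R)
    (r1 r2 : R) :
  (r1 <= r2)%R -> Xad D Reg r1 `<=` Xad D Reg r2.
Proof.
by move=> r12 x [Dx Rx]; split=> //; apply: (le_trans Rx); rewrite lee_fin.
Qed.

Lemma ivanov_exists {R : realType} {X Y : Type} (D : set X) (F : X -> Y)
    (Reg : X -> \bar R) (S : Y -> Y -> \bar R) (yd : Y) (r : R) :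
  (forall z w, 0 <= S z w) -> feasible_closed D F Reg S yd ->
  Xad D Reg r !=set0 -> ivanov_well_defined_from D F Reg S yd r.
Proof.
move=> S0 cl [a ra] rho r_rho.
apply: minimizer_exists => [|x|c cP]; [|exact: S0|].
  by exists a; exact: Xad_le ra.
have [|x [Dx Rx Sx]] := cl rho c; last by exists x.
move=> e e0; have [x [Dx Rx] Sx] := cP _ e0; exists x; split=> //.
by apply: (le_trans Rx); rewrite lee_fin lerDl ltW.
Qed.

Lemma morozov_exists {R : realType} {X Y : Type} (D : set X) (F : X -> Y)
    (Reg : X -> \bar R) (S : Y -> Y -> \bar R) (yd : Y) (tau delta : R) :
  (forall x, 0 <= Reg x) -> feasible_closed D F Reg S yd ->
  [set x | D x /\ S (F x) yd <= (tau * delta)%:E] !=set0 ->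
  exists x, morozov D F Reg S yd tau delta x.
Proof.
move=> R0 cl A0; apply: minimizer_exists => // c cP.
have [|x [Dx Rx Sx]] := cl c (tau * delta)%R; last by exists x.
move=> e e0; have [x [Dx Sx] Rx] := cP _ e0; exists x; split=> //.
by apply: (le_trans Sx); rewrite lee_fin lerDl ltW.
Qed.

(** * Radii for the Ivanov problem *)

Lemma ivanov_monotone {R : realType} {X Y : Type} (D : set X) (F : X -> Y)
    (Reg : X -> \bar R) (S : Y -> Y -> \bar R) (yd : Y) (r : R) :
  ivanov_monotone_from D F Reg S yd r.
Proof.
by move=> r1 r2 x1 x2 _ _ [A1 _] [_ min2] r12; apply/min2/(Xad_le r12).
Qed.

(** At the radius [Reg xMo], the Morozov minimizer bounds the Ivanov value by
    tau * delta; no smaller radius can do so, since a minimizer for it would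
    beat xMo in the Morozov problem. *)
Lemma morozov_rule_II {R : realType} {X Y : Type} (D : set X) (F : X -> Y)
    (Reg : X -> \bar R) (S : Y -> Y -> \bar R) (yd : Y) (tau delta rho : R)
    (xMo : X) :
  (forall x, 0 <= Reg x) -> (forall z w, 0 <= S z w) ->
  feasible_closed D F Reg S yd ->
  morozov D F Reg S yd tau delta xMo -> Reg xMo = rho%:E ->
  rule_II D F Reg S yd tau delta rho.
Proof.
move=> R0 S0 cl [[DMo SMo] minMo] RMo.
have AMo : Xad D Reg rho xMo by split; rewrite ?RMo.
split; first split.
- by rewrite -lee_fin -RMo.
- have [x xI] := ivanov_exists S0 cl (ex_intro _ _ AMo) (lexx rho).
  by exists x => //; exact: le_trans (xI.2 _ AMo) SMo.
- move=> r [_ [x [[Dx Rx] _] Sx]].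
  by rewrite -lee_fin -RMo; apply: le_trans Rx; exact: minMo.
Qed.

(** The sequence of radii rho * (1 - 1/(n+1)) increases to rho from below and
    starts at 0, hence it stays among the nonnegative radii. *)
Lemma residual_ge_from_below {R : realType} {X Y : Type} (D : set X)
    (F : X -> Y) (Reg : X -> \bar R) (S : Y -> Y -> \bar R) (yd : Y)
    (rho : R) (s : \bar R) (x : X) :
  (0 < rho)%R ->
  approximable D F Reg S yd [set r | (0 <= r)%R] rho ->
  (forall r x', (r < rho)%R -> Xad D Reg r x' -> s <= S (F x') yd) ->
  Xad D Reg rho x -> s <= S (F x) yd.
Proof.
move=> rho0 app ge_s Ax.
have [||phi phiA phi_cvg] := app (fun n => - rho * harmonic n)%R.
- rewrite -[X in _ --> X](mulr0 (- rho)%R); apply: cvgMr.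
  exact: cvg_harmonic.
- move=> n /=; rewrite mulNr subr_ge0 ler_piMr ?(ltW rho0)//= invf_le1 ?ler1n//.
apply: cvge_to_ge (phi_cvg x Ax) _; apply: nearW => n.
apply: ge_s (phiA n x Ax).
by rewrite mulNr gtrBl mulr_gt0 //= invr_gt0.
Qed.

(** Admissible sets of negative radius are empty, so that the jump of a zero
    sequence to a negative radius rules out any map into them. *)
Lemma approximable_setT_empty {R : realType} {X Y : Type} (D : set X)
    (F : X -> Y) (Reg : X -> \bar R) (S : Y -> Y -> \bar R) (yd : Y)
    (rho : R) (x : X) :
  (forall x, 0 <= Reg x) -> approximable D F Reg S yd [set: R] rho ->
  ~ Xad D Reg rho x.
Proof.
move=> R0 app Ax.
have [||phi phiA _] := app (fun n => if n is 0%N then (- rho - 1)%R else 0%R).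
- apply: cvg_near_cst; exists 1%N => // -[|n] //= _; exact: eqxx.
- by [].
have [_ /(le_trans (R0 _))] := phiA 0%N x Ax.
by rewrite lee_fin addrA subrr sub0r oppr_ge0 ler10.
Qed.

(** * Well-posedness and the three rules for the radius *)

Theorem theorem2p3 (R : realType) (X Y : topologicalType)
    (D : set X) (F : X -> Y) (y : Y)
    (Reg : X -> \bar R) (S : Y -> Y -> \bar R)
    (yd : Y) (tau delta : R) (xdag : X)
    (y_in_range : (F @` D) y)
    (Reg_ge0 : forall x, 0 <= Reg x)
    (S_ge0 : forall z w, 0 <= S z w)
    (tau_ge1 : (1 <= tau)%R)
    (delta_gt0 : (0 < delta)%R)
    (noise : S y yd <= delta%:E)
    (cond_i : sequentially_closed_map D F)
    (cond_ii : lower_semicontinuous Reg /\ lower_semicontinuous (S ^~ yd))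
    (cond_iii : forall C : R, (0 < C)%R ->
      sequentially_compact [set x | D x /\ Reg x <= C%:E])
    (cond_iv : forall (C : R) (w : Y), (0 < C)%R ->
      sequentially_compact [set z | (F @` D) z /\ S z w <= C%:E])
    (cond_v : exists2 x, solutions D F y x & Reg x < +oo)
    (xdag_min : minimizer (solutions D F y) Reg xdag) :
  exists rhoI rhoII : R,
  [/\ (* part (1) *)
      rule_I Reg xdag rhoI
      /\ rule_II D F Reg S yd tau delta rhoII,
      [/\ exists x, morozov D F Reg S yd tau delta x,
          ivanov_well_defined_from D F Reg S yd rhoII,
          exists x, ivanov D F Reg S yd rhoI x &
          exists x, ivanov D F Reg S yd rhoII x],
      [/\ (rhoII <= rhoI)%R,
          forall x, morozov D F Reg S yd tau delta x ->
            Reg x <= Reg xdag /\ S (F x) yd <= (tau * delta)%:E,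
          forall x, ivanov D F Reg S yd rhoI x ->
            Reg x <= Reg xdag /\ S (F x) yd <= delta%:E,
          forall x, ivanov D F Reg S yd rhoII x ->
            Reg x <= Reg xdag /\ S (F x) yd <= (tau * delta)%:E &
          ivanov_monotone_from D F Reg S yd rhoII],
      (* part (2), the zero sequences in (a) being unrestricted *)
      forall rho0 : R,
        rule_III_condition D F Reg S yd delta [set: R] rhoII rho0 ->
        [/\ ivanov_well_defined_from D F Reg S yd (Num.min rho0 rhoII),
            ivanov_monotone_from D F Reg S yd (Num.min rho0 rhoII),
            exists rho, rule_III D F Reg S yd tau delta rho &
            forall rho, rule_III D F Reg S yd tau delta rho ->
              (rho <= rhoI)%R /\
              forall x, ivanov D F Reg S yd rho x ->
                Reg x <= Reg xdag /\ S (F x) yd <= (tau * delta)%:E]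
    & (* part (2), the zero sequences in (a) being restricted to those with
         rho + d n >= 0; no radius satisfies rule III if tau = 1 *)
      forall rho0 : R,
        rule_III_condition D F Reg S yd delta [set r | (0 <= r)%R] rhoII rho0 ->
        [/\ ivanov_well_defined_from D F Reg S yd (Num.min rho0 rhoII),
            ivanov_monotone_from D F Reg S yd (Num.min rho0 rhoII),
            (1 < tau)%R -> exists rho, rule_III D F Reg S yd tau delta rho &
            forall rho, rule_III D F Reg S yd tau delta rho ->
              (rho <= rhoI)%R /\
              forall x, ivanov D F Reg S yd rho x ->
                Reg x <= Reg xdag /\ S (F x) yd <= (tau * delta)%:E]].
Proof.
have cl : feasible_closed D F Reg S yd.
  case: cond_ii => Rlsc Slsc.
  by apply: feasible_closedP => // C; exact: cond_iv.
have [[Ddag Fdag] min_dag] := xdag_min.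
have Rdag : Reg xdag \is a fin_num.
  rewrite ge0_fin_numE//; case: cond_v => x xsol; apply: le_lt_trans.
  exact: min_dag.
have Sdag : S (F xdag) yd <= delta%:E by rewrite Fdag.
have delta_le : (delta <= tau * delta)%R by rewrite ler_peMl // ltW.
have Mdag : D xdag /\ S (F xdag) yd <= (tau * delta)%:E.
  by split=> //; apply: (le_trans Sdag); rewrite lee_fin.
have [xMo xMoP] := morozov_exists Reg_ge0 cl (ex_intro _ _ Mdag).
have RMo_le x : D x -> S (F x) yd <= (tau * delta)%:E -> Reg xMo <= Reg x.
  by move=> Dx Sx; apply: xMoP.2.
have RMo : Reg xMo \is a fin_num.
  rewrite ge0_fin_numE//; apply: (le_lt_trans (RMo_le _ Ddag Mdag.2)).
  by rewrite ltey_eq Rdag.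
pose rhoI := fine (Reg xdag); pose rhoII := fine (Reg xMo).
have rhoIE : rhoI%:E = Reg xdag by rewrite fineK.
have rhoIIE : rhoII%:E = Reg xMo by rewrite fineK.
have II_I : (rhoII <= rhoI)%R.
  by rewrite -lee_fin rhoIE rhoIIE; exact: RMo_le Mdag.2.
have AI : Xad D Reg rhoI xdag by split; rewrite ?rhoIE.
have AII : Xad D Reg rhoII xMo by split; [exact: xMoP.1.1 | rewrite rhoIIE].
have wd := ivanov_exists S_ge0 cl (ex_intro _ _ AII).
have S_II x : ivanov D F Reg S yd rhoII x -> S (F x) yd <= (tau * delta)%:E.
  by move=> [_ minx]; exact: le_trans (minx _ AII) xMoP.1.2.
have III_le rho : rule_III D F Reg S yd tau delta rho -> (rho <= rhoI)%R.
  move=> [_ [x [_ minx] /andP[Sx _]]]; rewrite leNgt; apply/negP => /ltW I_le.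
  have := lt_le_trans Sx (minx _ (Xad_le I_le AI)).
  by rewrite ltNge Sdag.
have III_bound rho : rule_III D F Reg S yd tau delta rho ->
    (rho <= rhoI)%R /\ forall x, ivanov D F Reg S yd rho x ->
      Reg x <= Reg xdag /\ S (F x) yd <= (tau * delta)%:E.
  move=> rhoIII; have le_I := III_le _ rhoIII; split=> // x [[Dx Rx] minx].
  split; first by apply: (le_trans Rx); rewrite -rhoIE lee_fin.
  by case: rhoIII => _ [x' [Ax' _] /andP[_]]; apply: le_trans; exact: minx.
have wd_min adm rho0 : rule_III_condition D F Reg S yd delta adm rhoII rho0 ->
    ivanov_well_defined_from D F Reg S yd (Num.min rho0 rhoII).
  move=> [_ [x [Ax _] _] _]; apply: ivanov_exists => //.
  by case: leP => _; [exists x | exists xMo].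
have III_above rho0 adm :
    rule_III_condition D F Reg S yd delta adm rhoII rho0 ->
    (rhoII <= rho0)%R -> rule_III D F Reg S yd tau delta rho0.
  move=> [rho0_ge0 [x xI Sx] _] II_le; split=> //; exists x => //.
  rewrite Sx /=; have [xII xIIP] := wd _ (lexx rhoII).
  exact: le_trans (ivanov_monotone (lexx _) II_le xIIP xI II_le) (S_II _ xIIP).
exists rhoI, rhoII; split.
- split; first exact: rhoIE.
  by apply: morozov_rule_II xMoP _ => //; rewrite rhoIIE.
- split; [by exists xMo | exact: wd | exact: wd | exact: wd].
- split=> //.
  + by move=> x [[Dx Sx] minx]; split=> //; exact: minx.
  + move=> x [[Dx Rx] minx]; split; first by rewrite -rhoIE.
    exact: le_trans (minx _ AI) Sdag.
  + move=> x xI; split; last exact: S_II.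
    by apply: (le_trans xI.1.2); rewrite -rhoIE lee_fin.
  + exact: ivanov_monotone.
- move=> rho0 cond; split=> //; [exact: wd_min cond | exact: ivanov_monotone |].
  have [II_le|lt_II] := leP rhoII rho0.
    by exists rho0; exact: III_above cond _.
  case: cond => _ _ /(_ lt_II rhoII); rewrite lt_II lexx => /(_ isT)[app _].
  by have := approximable_setT_empty Reg_ge0 app AII.
- move=> rho0 cond; split=> //; [exact: wd_min cond | exact: ivanov_monotone |].
  move=> tau_gt1.
  have [II_le|lt_II] := leP rhoII rho0.
    by exists rho0; exact: III_above cond _.
  case: cond => rho0_ge0 _ /(_ lt_II rhoII).
  rewrite lt_II lexx => /(_ isT)[app _].
  have rhoII_gt0 : (0 < rhoII)%R := le_lt_trans rho0_ge0 lt_II.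
  have [x xI] := wd _ (lexx rhoII).
  exists rhoII; split; first exact: ltW.
  exists x => //; rewrite S_II// andbT.
  apply: (@lt_le_trans _ _ (tau * delta)%:E); first by rewrite lte_fin ltr_pMl.
  apply: (residual_ge_from_below rhoII_gt0 app _ xI.1) => r x' r_lt [Dx' Rx'].
  (* below the radius Reg xMo no point reaches the level tau * delta *)
  rewrite leNgt; apply/negP => /ltW /(RMo_le _ Dx').
  by rewrite leNgt -rhoIIE (le_lt_trans Rx')// lte_fin.
Qed.
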